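(* Let $M,T,N_{\rm s}$ be positive integers with $T\ge M$, let $\sigma_{\rm s}^2>0$, $\kappa=1/(\sigma_{\rm s}^2N_{\rm s})$, and let $\bm{R}\in\mathbb{C}^{M\times M}$ be the Hermitian positive definite matrix $\bm{R}=\mathbb{E}[\mathsf{H}_{\rm s}^{H}\mathsf{H}_{\rm s}]$, with eigendecomposition $\bm{R}=\bm{U}_{\rm s}\bm{\Lambda}_{\rm s}\bm{U}_{\rm s}^{H}$, where $\bm{U}_{\rm s}$ is unitary and $\bm{\Lambda}_{\rm s}=\mathrm{diag}(\lambda_1,\dots,\lambda_M)$. For a random matrix $\mathsf{X}\in\mathbb{C}^{M\times T}$ put $\mathsf{R}_{\mathsf{X}}=T^{-1}\mathsf{X}\mathsf{X}^{H}$ and $$J_{\rm EMMSE}(\mathsf{X})=\mathbb{E}\Big[\mathrm{tr}\big((\bm{R}^{-1}+\kappa T\,\mathsf{R}_{\mathsf{X}})^{-1}\big)\Big].$$ If $\mathsf{X}^\star$ minimizes $J_{\rm EMMSE}$ over all random matrices $\mathsf{X}\in\mathbb{C}^{M\times T}$ satisfying $\mathbb{E}[\mathrm{tr}(\mathsf{X}\mathsf{X}^{H})]=MT$, then: 1) the sample covariance matrix $\mathsf{R}_{\mathsf{X}^\star}$ is deterministic (almost surely equal to a constant matrix $\bm{R}_{\bm X}^\star$); 2) $\bm{R}_{\bm X}^\star=\bm{U}_{\rm s}(\bm{D}_{\rm s}^\star)^2\bm{U}_{\rm s}^{H}$ for a diagonal matrix $\bm{D}_{\rm s}^\star=\mathrm{diag}(d_1^\star,\dots,d_M^\star)$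 with $d_i^\star\ge 0$; 3) for every $i\in\{1,\dots,M\}$, $$(d_i^\star)^2=\frac{1}{\kappa T}\Big(\nu-\frac{1}{\lambda_i}\Big)^{+},$$ where $\nu\ge 0$ is the number ensuring $\sum_{i=1}^M(d_i^\star)^2=M$; 4) if $\mathsf{H}_{\rm s}$ is isotropically distributed, then $\bm{R}$ is a scalar multiple of the identity $\bm{I}_M$ and $d_i^\star=1$ for all $i$.
   Context: $\mathsf{H}_{\rm s}\in\mathbb{C}^{N_{\rm s}\times M}$ is a random matrix (the target response) with finite second moments such that $\mathbb{E}[\mathsf{H}_{\rm s}^{H}\mathsf{H}_{\rm s}]$ is invertible. $(\cdot)^H$ denotes conjugate transpose and $x^+=\max(x,0)$. $\mathsf{H}_{\rm s}$ is called isotropically distributed if $\mathsf{H}_{\rm s}\bm{U}$ has the same distribution as $\mathsf{H}_{\rm s}$ for every deterministic $M\times M$ unitary matrix $\bm{U}$. $J_{\rm EMMSE}$ is the ergodic (linear) minimum mean squared error used as sensing metric. *)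

(* Defs.v *)
From HB Require Import structures.
From mathcomp Require Import all_boot all_order all_algebra.
From mathcomp Require Import complex.
From mathcomp Require Import all_classical all_reals all_analysis.

Set Implicit Arguments.
Unset Strict Implicit.
Unset Printing Implicit Defensive.

Import Order.TTheory GRing.Theory Num.Theory.

Local Open Scope classical_set_scope.
Local Open Scope ring_scope.
Local Open Scope complex_scope.
Local Open Scope sesquilinear_scope.

Section random_matrices.
Context {R : realType}.

(* The sigma-algebra generated by these sets is the Borel sigma-algebra of the
   space of m x n complex matrices, identified with R ^ (2 m n). *)
Definition mx_cylinder m n : set (set 'M[R[i]]_(m, n)) :=
  [set A | exists (i : 'I_m) (j : 'I_n) (B : set R), measurable B /\
     (A = [set W : 'M[R[i]]_(m, n) | B (complex.Re (W i j))] \/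
      A = [set W : 'M[R[i]]_(m, n) | B (complex.Im (W i j))])].

Context {d : measure_display} {Omega : measurableType d}.

Definition random_matrix m n (X : Omega -> 'M[R[i]]_(m, n)) : Prop :=
  forall A, <<s @mx_cylinder m n >> A -> measurable (X @^-1` A).

Variable P : probability Omega R.

Definition same_law m n (X Y : Omega -> 'M[R[i]]_(m, n)) : Prop :=
  forall A, <<s @mx_cylinder m n >> A -> P (X @^-1` A) = P (Y @^-1` A).

Definition isotropic m n (H : Omega -> 'M[R[i]]_(m, n)) : Prop :=
  forall U : 'M[R[i]]_n, U \is unitarymx -> same_law (fun w => H w *m U) H.

Definition finite_second_moments m n (H : Omega -> 'M[R[i]]_(m, n)) : Prop :=
  forall i j, ('E_P[fun w => (Normc.normc (H w i j) ^+ 2)%R] < +oo)%E.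

(* Meaningful when the real and imaginary parts of all entries are
   integrable. *)
Definition mx_expectation m n (X : Omega -> 'M[R[i]]_(m, n)) :
    'M[R[i]]_(m, n) :=
  \matrix_(i, j) ((fine 'E_P[fun w => complex.Re (X w i j)]) +i*
                  (fine 'E_P[fun w => complex.Im (X w i j)])).

End random_matrices.

Section sensing.
Context {R : realType}.

Definition sample_cov m t (X : 'M[R[i]]_(m, t)) : 'M[R[i]]_m :=
  t%:R^-1 *: (X *m X^t*).

Definition real_diag m (v : 'rV[R]_m) : 'M[R[i]]_m :=
  diag_mx (map_mx (real_complex R) v).

Context {d : measure_display} {Omega : measurableType d}.
Variable P : probability Omega R.

(* Rs^-1 + kappa X X^H is Hermitian positive definite whenever Rs is and
   0 <= kappa, so the trace is real and equal to its real part. *)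
Definition J_EMMSE m t (Rs : 'M[R[i]]_m) (kappa : R)
    (X : Omega -> 'M[R[i]]_(m, t)) : \bar R :=
  'E_P[fun w => complex.Re
    (\tr (invmx (invmx Rs + (kappa * t%:R)%:C *: sample_cov (X w))))]%E.

Definition feasible m t (X : Omega -> 'M[R[i]]_(m, t)) : Prop :=
  random_matrix X /\
  ('E_P[fun w => complex.Re (\tr (X w *m (X w)^t*))] = (m * t)%:R%:E)%E.

Definition minimizes_EMMSE m t (Rs : 'M[R[i]]_m) (kappa : R)
    (X : Omega -> 'M[R[i]]_(m, t)) : Prop :=
  feasible X /\
  forall Y : Omega -> 'M[R[i]]_(m, t), feasible Y ->
    (J_EMMSE Rs kappa X <= J_EMMSE Rs kappa Y)%E.

End sensing.

Section water_filling.
Context {R : realType}.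

Definition water_power m (t : nat) (kappa : R) (lambda : 'rV[R]_m) (nu : R)
    (i : 'I_m) : R :=
  (kappa * t%:R)^-1 * Num.max (nu - (lambda 0 i)^-1) 0.

Definition is_water_level m (t : nat) (kappa : R) (lambda : 'rV[R]_m)
    (nu : R) : Prop :=
  0 <= nu /\ \sum_(i < m) water_power t kappa lambda nu i = m%:R.

End water_filling.

(* Main.v *)
(* The map S |-> tr S^-1 lies strictly above its tangents on positive definite
   matrices: tr S^-1 minus its tangent at D is tr (G S G) with G = S^-1 - D^-1.
   In the eigenbasis of Rs, take for D the diagonal matrix with entries
   max (nu, 1 / lambda_i), which is what the water-filling covariance produces.
   As nu is a lower bound of D, attained wherever power is allocated, the
   tangent inequality becomes
     mmse X + c |X|^2 >= const,   c = kappa / nu^2,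
   where equality forces X X^* to be the water-filling covariance.  The energy
   constraint fixes the expectation of |X|^2 and the deterministic water-filling
   input attains the constant, so equality holds almost surely at a minimizer.
   If Hs is isotropic, a unitary exchanging two eigenvectors of Rs preserves the
   law of Hs, hence all the lambda_i are equal. *)

Require Import Defs.
From HB Require Import structures.
From mathcomp Require Import all_boot all_order all_algebra.
From mathcomp Require Import complex.
From mathcomp Require Import ring lra.
From mathcomp Require Import measurable_realfun.
From mathcomp Require Import all_classical all_reals all_analysis.

Import Order.TTheory GRing.Theory Num.Theory.
Import numFieldNormedType.Exports.

Local Open Scope classical_set_scope.
Local Open Scope ring_scope.
Local Open Scope complex_scope.
Local Open Scope sesquilinear_scope.

Set Implicit Arguments.
Unset Strict Implicit.
Unset Printing Implicit Defensive.

(** * Traces of inverses of regularized Gram matrices *)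

Lemma mxtrace_mulmx_adj (C : numClosedFieldType) m n (A B : 'M[C]_(m, n)) :
  \tr (A *m B^t*) = \sum_i \sum_j A i j * Num.conj (B i j).
Proof.
by apply: eq_bigr => i _; rewrite mxE; apply: eq_bigr => j _; rewrite !mxE.
Qed.

Lemma mulmx_adj_diag (C : numClosedFieldType) m n (A : 'M[C]_(m, n)) i :
  (A *m A^t*) i i = \sum_j `|A i j| ^+ 2.
Proof. by rewrite mxE; apply: eq_bigr => j _; rewrite !mxE normCK. Qed.

Lemma mxtrace_mulmx_adj_ge0 (C : numClosedFieldType) m n (A : 'M[C]_(m, n)) :
  0 <= \tr (A *m A^t*).
Proof.
apply: sumr_ge0 => i _; rewrite mulmx_adj_diag.
by apply: sumr_ge0 => j _; rewrite exprn_ge0.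
Qed.

Lemma adj_mulmx (C : numClosedFieldType) m n p (A : 'M[C]_(m, n))
  (B : 'M[C]_(n, p)) : (A *m B)^t* = B^t* *m A^t*.
Proof. by rewrite trmx_mul map_mxM. Qed.

Lemma adjK (C : numClosedFieldType) m n (A : 'M[C]_(m, n)) : (A^t*)^t* = A.
Proof. by apply/matrixP => i j; rewrite !mxE conjCK. Qed.

Section regularized_gram.
Variables (C : numClosedFieldType) (n t : nat).
Variables (a : 'rV[C]_n) (k : C) (Y : 'M[C]_(n, t)).
Hypotheses (a_gt0 : forall i, 0 < a 0 i) (k_ge0 : 0 <= k).

(** This is [Rs^-1 + kappa X X^*] written in the eigenbasis of [Rs]: [a] holds the inverse
    eigenvalues, and [Y] is the input rotated by [Us^t*]. *)
Definition regularized_gram : 'M[C]_n := diag_mx a + k *: (Y *m Y^t*).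
Local Notation S := regularized_gram.

Lemma regularized_gram_form_ge m (G : 'M[C]_(m, n)) :
  \sum_i \sum_j a 0 j * `|G i j| ^+ 2 <= \tr (G *m S *m G^t*).
Proof.
have -> : \tr (G *m S *m G^t*) = \sum_i \sum_j a 0 j * `|G i j| ^+ 2 +
                                k * \tr ((G *m Y) *m (G *m Y)^t*).
  rewrite mulmxDr mulmxDl mxtraceD; congr (_ + _).
    rewrite mxtrace_mulmx_adj; apply: eq_bigr => i _; apply: eq_bigr => j _.
    by rewrite mul_mx_diag mxE normCK mulrCA mulrA mulrC.
  by rewrite -scalemxAr -scalemxAl mxtraceZ adj_mulmx !mulmxA.
by rewrite lerDl mulr_ge0// mxtrace_mulmx_adj_ge0.
Qed.

Lemma regularized_gram_form_ge0 m (G : 'M[C]_(m, n)) :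
  0 <= \tr (G *m S *m G^t*).
Proof.
apply: le_trans _ (regularized_gram_form_ge G).
by do 2!apply: sumr_ge0 => ? _; rewrite mulr_ge0 ?exprn_ge0// ltW.
Qed.

Lemma regularized_gram_form_eq0 m (G : 'M[C]_(m, n)) :
  \tr (G *m S *m G^t*) = 0 -> G = 0.
Proof.
move=> G0; have := regularized_gram_form_ge G; rewrite G0 => le0.
have ge0 i j : 0 <= a 0 j * `|G i j| ^+ 2.
  by rewrite mulr_ge0 ?exprn_ge0// ltW.
have ge0' i : 0 <= \sum_j a 0 j * `|G i j| ^+ 2 by exact: sumr_ge0.
have /eqP : \sum_i \sum_j a 0 j * `|G i j| ^+ 2 = 0.
  by apply/eqP; rewrite eq_le le0 sumr_ge0.
rewrite psumr_eq0// => /allP Gi0; apply/matrixP => i j; rewrite mxE.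
have := Gi0 i (mem_index_enum _); rewrite /= psumr_eq0// => /allP/(_ j).
rewrite mem_index_enum => /(_ isT) /=.
by rewrite mulf_eq0 gt_eqF//= expf_eq0/= normr_eq0 => /eqP.
Qed.

Lemma regularized_gram_unit : S \in unitmx.
Proof.
rewrite -row_free_unit; apply: inj_row_free => v vS0.
by apply: regularized_gram_form_eq0; rewrite vS0 mul0mx mxtrace0.
Qed.

Lemma regularized_gram_hermitian : S^t* = S.
Proof.
rewrite /S raddfD map_mxD/= tr_diag_mx map_diag_mx; congr (_ + _).
  congr diag_mx; apply/matrixP => i j; rewrite mxE ord1.
  by apply/conj_Creal/gtr0_real.
rewrite linearZ/= map_mxZ; congr (_ *: _); last by rewrite adj_mulmx adjK.
by apply/conj_Creal/ger0_real.
Qed.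

Lemma regularized_gram_inv_hermitian : (invmx S)^t* = invmx S.
Proof. by rewrite trmx_inv map_invmx regularized_gram_hermitian. Qed.

Lemma trace_inv_ge0 : 0 <= \tr (invmx S).
Proof.
have := regularized_gram_form_ge0 (invmx S).
by rewrite mulVmx ?regularized_gram_unit// mul1mx regularized_gram_inv_hermitian.
Qed.

(* gap is the difference between the convex function S |-> tr S^-1 and its
   tangent at D = diag b; it equals tr (G S G^* ) for G = S^-1 - D^-1. *)
Lemma trace_inv_gap (b : 'rV[C]_n) : (forall i, 0 < b 0 i) ->
  let gap := \tr (invmx S) - \sum_i (2 / b 0 i -
     (a 0 i + k * \sum_j `|Y i j| ^+ 2) / b 0 i ^+ 2) in
  0 <= gap /\ (gap = 0 -> S = diag_mx b).
Proof.
move=> b_gt0 gap.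
pose E : 'M[C]_n := diag_mx (\row_i (b 0 i)^-1).
have bE : diag_mx b *m E = 1%:M.
  rewrite mulmx_diag -diag_const_mx; congr diag_mx.
  by apply/rowP => i; rewrite !mxE mulfV// gt_eqF.
have Eherm : E^t* = E.
  rewrite tr_diag_mx map_diag_mx; congr diag_mx; apply/rowP => i; rewrite !mxE.
  by apply/conj_Creal/gtr0_real; rewrite invr_gt0.
have SV := mulmxV regularized_gram_unit; have VS := mulVmx regularized_gram_unit.
have SiE := regularized_gram_inv_hermitian.
have gapE : gap = \tr ((invmx S - E) *m S *m (invmx S - E)^t*).
  have -> : (invmx S - E)^t* = invmx S - E by rewrite raddfB map_mxB SiE Eherm.
  have -> : (invmx S - E) *m S *m (invmx S - E) =
            invmx S - (E + E - E *m S *m E).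
    rewrite mulmxBl VS mulmxBr !mulmxBl !mul1mx.
    by rewrite -[E *m S *m invmx S]mulmxA SV mulmx1 -addrA -opprD addrA.
  rewrite raddfB/= [\tr (_ - _ *m _)]raddfB/= mxtraceD /E mxtrace_diag; congr (_ - _).
  rewrite -big_split -sumrB/=; apply: eq_bigr => i _.
  (* As [E] is diagonal, the trace of [E *m S *m E] sees only the diagonal of [S]; this is why the
     tangent is a scalar sum. *)
  have Sii : S i i = a 0 i + k * \sum_j `|Y i j| ^+ 2.
    by rewrite mxE [X in X + _]mxE [X in _ + X]mxE mulmx_adj_diag eqxx.
  rewrite mul_mx_diag mul_diag_mx 3!mxE Sii !mxE.
  have := b_gt0 i; rewrite lt0r => /andP[b0 _].
  by field.
rewrite gapE; split; first exact: regularized_gram_form_ge0.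
move=> /regularized_gram_form_eq0/eqP; rewrite subr_eq0 => /eqP SiEE.
by rewrite -[LHS]mul1mx -bE -SiEE -mulmxA VS mulmx1.
Qed.

End regularized_gram.

(** * Water levels *)

Section water_level.
Variables (R : realType) (m t : nat) (kappa : R) (lambda : 'rV[R]_m).
Hypotheses (m_gt0 : (0 < m)%N) (kt_gt0 : 0 < kappa * t%:R).
Hypothesis lambda_gt0 : forall i, 0 < lambda 0 i.

Let power nu := \sum_(i < m) water_power t kappa lambda nu i.

Lemma water_power_ge0 nu i : 0 <= water_power t kappa lambda nu i.
Proof. by rewrite mulr_ge0 ?invr_ge0 ?(ltW kt_gt0)// le_max lexx orbT. Qed.

Lemma water_power_homo i : {homo (fun nu => water_power t kappa lambda nu i) :
  x y / x <= y}.
Proof.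
move=> x y xy; rewrite ler_wpM2l ?invr_ge0 ?(ltW kt_gt0)//.
by rewrite le_max2 ?lerD2r.
Qed.

(** Positive total power means that some channel lies strictly below level [x]; that channel gains
    strictly and no other loses. Uniqueness of the level follows, the required total being
    positive. *)
Lemma total_water_power_lt x y : x < y -> 0 < power x -> power x < power y.
Proof.
move=> xy; rewrite {1}/power lt0r => /andP[+ _].
rewrite psumr_neq0 => [/hasP[i _ /= powi]|i _]; last exact: water_power_ge0.
rewrite /power [ltLHS](bigD1 i)//= [ltRHS](bigD1 i)//=.
rewrite ltr_leD ?ler_sum// => [|j _]; last exact/water_power_homo/ltW.
move: powi; rewrite /water_power pmulr_rgt0 ?invr_gt0// lt_max ltxx orbF => xi.
rewrite ltr_pM2l ?invr_gt0// gt_max !lt_max ltrD2r xy/= ltxx orbF.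
by rewrite (lt_trans xi)// ltrD2r.
Qed.

Lemma total_water_power_continuous : continuous power.
Proof.
apply: (@continuous_big R) => [|i _]; first exact: add_continuous.
move=> x; apply: cvgM; first exact: cvg_cst.
apply: (@continuous_max R R (fun y => y - (lambda 0 i)^-1) (fun=> 0)).
  by apply: cvgB; [exact: cvg_id|exact: cvg_cst].
exact: cvg_cst.
Qed.

Lemma total_water_power0 : power 0 = 0.
Proof.
rewrite /power big1// => i _; rewrite /water_power sub0r max_r ?mulr0//.
by rewrite oppr_le0 invr_ge0 ltW.
Qed.

Lemma water_level_unique_exists :
  exists nu, unique (is_water_level t kappa lambda) nu /\ 0 < nu.
Proof.
(* At level [b] the channel [i0] alone already receives power [m], so the intermediate value theorem
   applies on the interval from 0 to [b]. *)
pose i0 := Ordinal m_gt0; pose b := (lambda 0 i0)^-1 + kappa * t%:R * m%:R.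
have b_ge0 : 0 <= b.
  by rewrite addr_ge0 ?invr_ge0 ?(ltW (lambda_gt0 _))// mulr_ge0 ?ler0n// ltW.
have power_b : m%:R <= power b.
  rewrite /power (bigD1 i0)//= /water_power -[leLHS]addr0.
  apply: lerD; last by apply: sumr_ge0 => i _; exact: water_power_ge0.
  rewrite addrAC subrr add0r max_l ?(mulr_ge0 (ltW kt_gt0))//.
  by rewrite mulKf// gt_eqF.
have m_gt0' : 0 < m%:R :> R by rewrite ltr0n.
have [||nu] := @IVT R power 0 b m%:R b_ge0.
- by apply: continuous_subspaceT; exact: total_water_power_continuous.
- by rewrite total_water_power0 ge_min le_max ler0n power_b orbT.
rewrite in_itv/= => /andP[nu_ge0 _] powernu.
have uniq x : is_water_level t kappa lambda x -> nu = x.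
  move=> [x_ge0 powerx]; apply/eqP; rewrite eq_le !leNgt; apply/andP; split.
    apply/negP => /total_water_power_lt.
    by rewrite -/(power x) in powerx; rewrite powerx powernu ltxx => /(_ m_gt0').
  apply/negP => /total_water_power_lt.
  by rewrite -/(power x) in powerx; rewrite powerx powernu ltxx => /(_ m_gt0').
exists nu; split; first by [].
rewrite lt_neqAle nu_ge0 andbT; apply/eqP => nu0.
by move: m_gt0'; rewrite -powernu -nu0 total_water_power0 ltxx.
Qed.

End water_level.

(** * Measurability and expectation of complex matrices *)

Section complex_measurability.
Context {R : realType} {d : measure_display} {Omega : measurableType d}.

(** Real and imaginary parts are treated separately to match the generators in [mx_cylinder]. *)
Definition complex_measurable (f : Omega -> R[i]) : Prop :=
  measurable_fun setT (fun w => complex.Re (f w)) /\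
  measurable_fun setT (fun w => complex.Im (f w)).

Lemma ReM (x y : R[i]) : complex.Re (x * y) =
  complex.Re x * complex.Re y - complex.Im x * complex.Im y.
Proof. by case: x y => [? ?] [? ?]. Qed.

Lemma ImM (x y : R[i]) : complex.Im (x * y) =
  complex.Re x * complex.Im y + complex.Im x * complex.Re y.
Proof. by case: x y => [? ?] [? ?]. Qed.

Lemma ReD (x y : R[i]) : complex.Re (x + y) = complex.Re x + complex.Re y.
Proof. by case: x y => [? ?] [? ?]. Qed.

Lemma ImD (x y : R[i]) : complex.Im (x + y) = complex.Im x + complex.Im y.
Proof. by case: x y => [? ?] [? ?]. Qed.

Lemma complex_measurable_cst c : complex_measurable (fun=> c).
Proof. by split; exact: measurable_cst. Qed.

Lemma complex_measurableD f g : complex_measurable f -> complex_measurable g ->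
  complex_measurable (fun w => f w + g w).
Proof.
move=> [f1 f2] [g1 g2]; split.
- by under eq_fun do rewrite ReD; exact: measurable_funD.
- by under eq_fun do rewrite ImD; exact: measurable_funD.
Qed.

Lemma complex_measurableM f g : complex_measurable f -> complex_measurable g ->
  complex_measurable (fun w => f w * g w).
Proof.
move=> [f1 f2] [g1 g2]; split.
- under eq_fun do rewrite ReM.
  by apply: measurable_funB; exact: measurable_funM.
- under eq_fun do rewrite ImM.
  by apply: measurable_funD; exact: measurable_funM.
Qed.

Lemma complex_measurable_conj f : complex_measurable f ->
  complex_measurable (fun w => Num.conj (f w)).
Proof.
move=> [f1 f2]; split.
- by rewrite (_ : (fun w => _) = (fun w => complex.Re (f w)))//;
    apply/funext => w; case: (f w).
- rewrite (_ : (fun w => _) = (fun w => - complex.Im (f w))).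
    exact: measurableT_comp.
  by apply/funext => w; case: (f w).
Qed.

Lemma complex_measurable_inv f : complex_measurable f ->
  complex_measurable (fun w => (f w)^-1).
Proof.
move=> [f1 f2].
have sq_ge0 w : 0 <= complex.Re (f w) ^+ 2 + complex.Im (f w) ^+ 2.
  by rewrite addr_ge0 ?sqr_ge0.
have msq : measurable_fun setT
    (fun w => (complex.Re (f w) ^+ 2 + complex.Im (f w) ^+ 2)^-1).
  (* On nonnegative reals the inverse, with its default [0^-1 = 0], is the power with exponent -1, a
     measurable function. *)
  under eq_fun => w do rewrite -powR_inv1//.
  apply: (measurableT_comp (@measurable_powR R (-1))).
  by apply: measurable_funD; exact: measurable_funX.
split.
- rewrite (_ : (fun w => _) = (fun w => complex.Re (f w) *
      (complex.Re (f w) ^+ 2 + complex.Im (f w) ^+ 2)^-1)).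
    exact: measurable_funM.
  by apply/funext => w; case: (f w).
- rewrite (_ : (fun w => _) = (fun w => - (complex.Im (f w) *
      (complex.Re (f w) ^+ 2 + complex.Im (f w) ^+ 2)^-1))).
    by apply: measurableT_comp => //; exact: measurable_funM.
  by apply/funext => w; case: (f w).
Qed.

Lemma complex_measurable_sum I (s : seq I) (p : pred I) (F : I -> Omega -> R[i]) :
  (forall i, complex_measurable (F i)) ->
  complex_measurable (fun w => \sum_(i <- s | p i) F i w).
Proof.
move=> mF; elim: s => [|i s IH].
  by under eq_fun do rewrite big_nil; exact: complex_measurable_cst.
under eq_fun do rewrite big_cons.
by case: (p i) => //; exact: complex_measurableD.
Qed.

Lemma complex_measurable_prod I (s : seq I) (p : pred I) (F : I -> Omega -> R[i]) :
  (forall i, complex_measurable (F i)) ->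
  complex_measurable (fun w => \prod_(i <- s | p i) F i w).
Proof.
move=> mF; elim: s => [|i s IH].
  by under eq_fun do rewrite big_nil; exact: complex_measurable_cst.
under eq_fun do rewrite big_cons.
by case: (p i) => //; exact: complex_measurableM.
Qed.

Definition mx_measurable m n (X : Omega -> 'M[R[i]]_(m, n)) : Prop :=
  forall i j, complex_measurable (fun w => X w i j).

Lemma random_matrix_measurable m n (X : Omega -> 'M[R[i]]_(m, n)) :
  random_matrix X -> mx_measurable X.
Proof.
move=> mX i j; split=> _ B mB; rewrite setTI.
- apply: (mX [set W : 'M[R[i]]_(m, n) | B (complex.Re (W i j))]).
  by apply: sub_sigma_algebra; exists i, j, B; split; [|left].
- apply: (mX [set W : 'M[R[i]]_(m, n) | B (complex.Im (W i j))]).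
  by apply: sub_sigma_algebra; exists i, j, B; split; [|right].
Qed.

Lemma random_matrix_cst m n (A : 'M[R[i]]_(m, n)) :
  random_matrix (fun _ : Omega => A).
Proof. by move=> B _; rewrite preimage_cst; case: ifP. Qed.

Lemma mx_measurable_cst m n (A : 'M[R[i]]_(m, n)) :
  mx_measurable (fun _ : Omega => A).
Proof. by move=> i j; exact: complex_measurable_cst. Qed.

Lemma mx_measurableD m n (X Y : Omega -> 'M[R[i]]_(m, n)) :
  mx_measurable X -> mx_measurable Y -> mx_measurable (fun w => X w + Y w).
Proof.
by move=> mX mY i j; under eq_fun do rewrite mxE; exact: complex_measurableD.
Qed.

Lemma mx_measurableZ m n (c : R[i]) (X : Omega -> 'M[R[i]]_(m, n)) :
  mx_measurable X -> mx_measurable (fun w => c *: X w).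
Proof.
move=> mX i j; under eq_fun do rewrite mxE.
by apply: complex_measurableM; first exact: complex_measurable_cst.
Qed.

Lemma mx_measurableM m n p (X : Omega -> 'M[R[i]]_(m, n))
    (Y : Omega -> 'M[R[i]]_(n, p)) :
  mx_measurable X -> mx_measurable Y -> mx_measurable (fun w => X w *m Y w).
Proof.
move=> mX mY i j; under eq_fun do rewrite mxE.
by apply: complex_measurable_sum => k; exact: complex_measurableM.
Qed.

Lemma mx_measurable_adj m n (X : Omega -> 'M[R[i]]_(m, n)) :
  mx_measurable X -> mx_measurable (fun w => (X w)^t*).
Proof.
move=> mX i j; under eq_fun do rewrite !mxE.
exact: complex_measurable_conj.
Qed.

Lemma complex_measurable_tr n (X : Omega -> 'M[R[i]]_n) :
  mx_measurable X -> complex_measurable (fun w => \tr (X w)).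
Proof. by move=> mX; exact: complex_measurable_sum. Qed.

Lemma complex_measurable_det n (X : Omega -> 'M[R[i]]_n) :
  mx_measurable X -> complex_measurable (fun w => \det (X w)).
Proof.
move=> mX; apply: complex_measurable_sum => s.
apply: complex_measurableM; first exact: complex_measurable_cst.
exact: complex_measurable_prod.
Qed.

Lemma mx_measurable_inv n (X : Omega -> 'M[R[i]]_n) :
  (forall w, X w \in unitmx) -> mx_measurable X ->
  mx_measurable (fun w => invmx (X w)).
Proof.
(* Invertibility at every [w] selects the cofactor branch of [invmx], so each entry is a signed
   minor divided by the determinant. *)
move=> uX mX i j; under eq_fun do rewrite /invmx uX !mxE.
apply: complex_measurableM.
  exact/complex_measurable_inv/complex_measurable_det.
apply: complex_measurableM; first exact: complex_measurable_cst.
by apply: complex_measurable_det => ? ?; under eq_fun do rewrite !mxE.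
Qed.

End complex_measurability.

(** * Expectations determined by the law of a random matrix *)

Section law_invariance.
Context {R : realType} {d : measure_display} {Omega : measurableType d}.
Variable P : probability Omega R.

#[local] HB.instance Definition _ := isPointed.Build R[i] 0.

(** This lets the closure lemmas for random matrices also prove measurability of functions defined
    on the matrix space itself. *)
Lemma mx_measurable_cylinder_id m n :
  mx_measurable (fun W : g_sigma_algebraType (@mx_cylinder R m n) => W).
Proof. exact: random_matrix_measurable. Qed.

(** Each expectation is an integral over the reals against the law of [phi], and the preimage under
    [phi] of a Borel set lies in the cylinder sigma-algebra, where the two laws agree. *)
Lemma same_law_expectation m n (X Y : Omega -> 'M[R[i]]_(m, n))
    (phi : 'M[R[i]]_(m, n) -> R) :
  measurable_fun setT (phi : g_sigma_algebraType (@mx_cylinder R m n) -> R) ->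
  (forall W, 0 <= phi W) ->
  measurable_fun setT (phi \o X) -> measurable_fun setT (phi \o Y) ->
  same_law P X Y -> ('E_P[phi \o X] = 'E_P[phi \o Y])%E.
Proof.
move=> mphi phi_ge0 mX mY XY; rewrite unlock.
(* The absolute value agrees with the identity on the values of [phi] and is nonnegative on the
   whole line, as the change of variables requires. *)
pose f (x : R) := `|x|%:E.
have mf : measurable_fun setT f by exact: measurableT_comp.
have push (Z : Omega -> 'M[R[i]]_(m, n)) (mZ : measurable_fun setT (phi \o Z)) :
    (\int[P]_w ((phi \o Z) w)%:E = \int[pushforward P (phi \o Z)]_x f x)%E.
  rewrite (ge0_integral_pushforward mZ)//; last first.
    by move=> x _; rewrite /f lee_fin.
  by apply: eq_integral => w _ /=; rewrite /f ger0_norm.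
rewrite (push X mX) (push Y mY).
apply: eq_measure_integral => A mA _; apply: (XY (phi @^-1` A)).
by have := mphi measurableT A mA; rewrite setTI.
Qed.

End law_invariance.

(** * Linearity of complex expectations and integrability of Gram entries *)

Section complex_expectation.
Context {R : realType} {d : measure_display} {Omega : measurableType d}.
Variable P : probability Omega R.

Local Notation rintegrable f := (P.-integrable setT (fun w => (f w)%:E)).
Local Notation rexpectation f := (fine (expectation P f)).

Lemma rexpectationD (f g : Omega -> R) : rintegrable f -> rintegrable g ->
  rexpectation (fun w => f w + g w) = rexpectation f + rexpectation g.
Proof. by move=> f1 g1; rewrite unlock; exact: (RintegralD measurableT f1 g1). Qed.

Lemma rexpectationZ (r : R) (f : Omega -> R) : rintegrable f ->
  rexpectation (fun w => r * f w) = r * rexpectation f.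
Proof. by move=> f1; rewrite unlock; exact: (RintegralZl r measurableT f1). Qed.

Lemma rintegrableD (f g : Omega -> R) : rintegrable f -> rintegrable g ->
  rintegrable (fun w => f w + g w).
Proof. by move=> f1 g1; exact: (integrableD measurableT f1 g1). Qed.

Lemma rintegrableZ (r : R) (f : Omega -> R) : rintegrable f ->
  rintegrable (fun w => r * f w).
Proof. by move=> f1; exact: (integrableZl measurableT r f1). Qed.

Definition complex_integrable (f : Omega -> R[i]) : Prop :=
  rintegrable (fun w => complex.Re (f w)) /\
  rintegrable (fun w => complex.Im (f w)).

Definition complex_expectation (f : Omega -> R[i]) : R[i] :=
  rexpectation (fun w => complex.Re (f w)) +i*
  rexpectation (fun w => complex.Im (f w)).

Lemma complex_integrable0 : complex_integrable (fun=> 0).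
Proof. by split; exact: integrable0. Qed.

Lemma complex_expectation0 : complex_expectation (fun=> 0) = 0.
Proof. by rewrite /complex_expectation/= expectation_cst. Qed.

Lemma complex_integrableD f g : complex_integrable f -> complex_integrable g ->
  complex_integrable (fun w => f w + g w).
Proof.
move=> [f1 f2] [g1 g2]; split.
- by under eq_fun do rewrite ReD; exact: rintegrableD.
- by under eq_fun do rewrite ImD; exact: rintegrableD.
Qed.

Lemma complex_expectationD f g : complex_integrable f -> complex_integrable g ->
  complex_expectation (fun w => f w + g w) =
  complex_expectation f + complex_expectation g.
Proof.
move=> [f1 f2] [g1 g2]; rewrite /complex_expectation.
under eq_fun do rewrite ReD; under [X in _ +i* fine (expectation P X)]eq_fun do rewrite ImD.
by rewrite !rexpectationD.
Qed.

Lemma complex_integrableZ c f : complex_integrable f ->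
  complex_integrable (fun w => c * f w).
Proof.
move=> [f1 f2]; split.
- under eq_fun do rewrite ReM -mulNr.
  by apply: rintegrableD; exact: rintegrableZ.
- under eq_fun do rewrite ImM.
  by apply: rintegrableD; exact: rintegrableZ.
Qed.

Lemma complex_expectationZ c f : complex_integrable f ->
  complex_expectation (fun w => c * f w) = c * complex_expectation f.
Proof.
move=> [f1 f2]; rewrite /complex_expectation.
under eq_fun do rewrite ReM -mulNr.
under [X in _ +i* fine (expectation P X)]eq_fun do rewrite ImM.
have Z1 r := rintegrableZ r f1; have Z2 r := rintegrableZ r f2.
rewrite !rexpectationD// !rexpectationZ//.
by case: c => a b; rewrite mulNr.
Qed.

Lemma complex_integrable_sum I (s : seq I) (F : I -> Omega -> R[i]) :
  (forall i, complex_integrable (F i)) ->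
  complex_integrable (fun w => \sum_(i <- s) F i w).
Proof.
move=> F1; elim: s => [|i s IH].
  by under eq_fun do rewrite big_nil; exact: complex_integrable0.
by under eq_fun do rewrite big_cons; exact: complex_integrableD.
Qed.

Lemma complex_expectation_sum I (s : seq I) (F : I -> Omega -> R[i]) :
  (forall i, complex_integrable (F i)) ->
  complex_expectation (fun w => \sum_(i <- s) F i w) =
  \sum_(i <- s) complex_expectation (F i).
Proof.
move=> F1; elim: s => [|i s IH].
  under eq_fun do rewrite big_nil.
  by rewrite big_nil complex_expectation0.
under eq_fun do rewrite big_cons.
by rewrite big_cons complex_expectationD ?IH//; exact: complex_integrable_sum.
Qed.

Lemma mx_expectation_mulmx m n p q (A : 'M[R[i]]_(m, n)) (B : 'M[R[i]]_(p, q))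
    (Z : Omega -> 'M[R[i]]_(n, p)) :
  (forall i j, complex_integrable (fun w => Z w i j)) ->
  mx_expectation P (fun w => A *m Z w *m B) = A *m mx_expectation P Z *m B.
Proof.
move=> Z1; apply/matrixP => i j; rewrite !mxE.
rewrite -[LHS]/(complex_expectation (fun w => (A *m Z w *m B) i j)).
under eq_fun do rewrite mxE.
have AZ1 k : complex_integrable (fun w => (A *m Z w) i k).
  under eq_fun do rewrite mxE.
  by apply: complex_integrable_sum => l; exact: complex_integrableZ.
rewrite complex_expectation_sum => [|k]; last first.
  by under eq_fun do rewrite mulrC; exact: complex_integrableZ.
apply: eq_bigr => k _; under eq_fun do rewrite mulrC.
rewrite complex_expectationZ// mulrC; congr (_ * _).
under eq_fun do rewrite mxE.
rewrite mxE complex_expectation_sum => [|l]; last exact: complex_integrableZ.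
by apply: eq_bigr => l _; rewrite complex_expectationZ// mxE.
Qed.

(** Products of two entries are dominated by the sum of their squared moduli, [g] below, which is
    integrable by the second moment assumption. *)
Lemma gram_integrable m n (H : Omega -> 'M[R[i]]_(m, n)) :
  random_matrix H -> finite_second_moments P H ->
  forall i j, complex_integrable (fun w => ((H w)^t* *m H w) i j).
Proof.
move=> /random_matrix_measurable mH H2 i j.
under eq_fun do rewrite mxE.
apply: complex_integrable_sum => k; under eq_fun do rewrite !mxE.
pose g w := Normc.normc (H w k i) ^+ 2 + Normc.normc (H w k j) ^+ 2.
have normc2 (z : R[i]) : Normc.normc z ^+ 2 =
    complex.Re z ^+ 2 + complex.Im z ^+ 2.
  by case: z => x y; rewrite /= sqr_sqrtr// addr_ge0 ?sqr_ge0.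
have g1 l : rintegrable (fun w => Normc.normc (H w k l) ^+ 2).
  have [m1 m2] := mH k l.
  apply/integrableP; split.
    apply/measurable_EFinP; under eq_fun do rewrite normc2.
    by apply: measurable_funD; exact: measurable_funX.
  have := H2 k l; rewrite unlock; congr (_ < _)%E.
  by apply: eq_integral => w _ /=; rewrite ger0_norm// sqr_ge0.
have gint : rintegrable g by exact: rintegrableD.
have [m1 m2] : complex_measurable (fun w => Num.conj (H w k i) * H w k j).
  by apply: complex_measurableM => //; exact: complex_measurable_conj.
have bound (a b c e : R) : `|a * b| + `|c * e| <= (a ^+ 2 + c ^+ 2) + (b ^+ 2 + e ^+ 2).
  rewrite !normrM -(real_normK (num_real a)) -(real_normK (num_real b)).
  rewrite -(real_normK (num_real c)) -(real_normK (num_real e)).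
  move: `|a| `|b| `|c| `|e| => x y z t.
  have := sqr_ge0 (x - y); have := sqr_ge0 (z - t).
  by have := sqr_ge0 (x + y); have := sqr_ge0 (z + t); lra.
split; apply: (le_integrable measurableT _ _ gint).
- exact/measurable_EFinP.
- move=> w _; rewrite lee_fin [leRHS]ger0_norm ?addr_ge0 ?sqr_ge0//.
  rewrite /g !normc2 ReM; apply: le_trans (ler_normB _ _) _.
  by case: (H w k i) (H w k j) => [a b] [c e] /=; rewrite mulNr normrN bound.
- exact/measurable_EFinP.
- move=> w _; rewrite lee_fin [leRHS]ger0_norm ?addr_ge0 ?sqr_ge0//.
  rewrite /g !normc2 ImM; apply: le_trans (ler_normD _ _) _.
  case: (H w k i) (H w k j) => [a b] [c e] /=; rewrite mulNr normrN.
  by rewrite [c ^+ 2 + _]addrC bound.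
Qed.

End complex_expectation.

(** * Eigenvalues of the second moment matrix *)

Section sensing_law.
Context {R : realType} {d : measure_display} {Omega : measurableType d}.
Variable P : probability Omega R.

(** This is the squared norm of [W] applied to the [i]-th column of [U]. *)
Definition column_energy m n (U : 'M[R[i]]_n) (i : 'I_n)
    (W : 'M[R[i]]_(m, n)) : R :=
  complex.Re (((W *m U)^t* *m (W *m U)) i i).

Lemma column_energy_ge0 m n (U : 'M[R[i]]_n) (i : 'I_n) (W : 'M[R[i]]_(m, n)) :
  0 <= column_energy U i W.
Proof.
suff : 0 <= ((W *m U)^t* *m (W *m U)) i i by rewrite lecE => /andP[].
rewrite mxE; apply: sumr_ge0 => k _.
by rewrite !mxE [_ * _]mulrC -normCK exprn_ge0.
Qed.

(** Linearity moves the conjugation by [U] inside the expectation, and the diagonal is then read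
    off. This gives both the sign of the eigenvalues and their comparison under isotropy. *)
Lemma eigenvalue_column_energy m n (H : Omega -> 'M[R[i]]_(m, n))
    (U : 'M[R[i]]_n) (lambda : 'rV[R]_n) :
  random_matrix H -> finite_second_moments P H -> U \is unitarymx ->
  mx_expectation P (fun w => (H w)^t* *m H w) =
    U *m real_diag lambda *m U^t* ->
  forall i, lambda 0 i = fine (expectation P (column_energy U i \o H)).
Proof.
move=> mH H2 /unitarymxP UU HU i.
have UU' : U^t* *m U = 1%:M by exact: mulmx1C.
have E1 := gram_integrable mH H2.
have := mx_expectation_mulmx (U^t*) U E1.
rewrite HU !mulmxA UU' mul1mx -mulmxA UU' mulmx1 => /matrixP/(_ i i).
rewrite !mxE eqxx mulr1n => /(congr1 (@complex.Re R)) /= <-.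
congr (fine (expectation P _)); apply/funext => w.
by rewrite /column_energy /= adj_mulmx !mulmxA.
Qed.

Lemma isotropic_eigenvalues m n (H : Omega -> 'M[R[i]]_(m, n))
    (U : 'M[R[i]]_n) (lambda : 'rV[R]_n) :
  random_matrix H -> finite_second_moments P H -> U \is unitarymx ->
  mx_expectation P (fun w => (H w)^t* *m H w) =
    U *m real_diag lambda *m U^t* ->
  isotropic P H -> forall i j, lambda 0 i = lambda 0 j.
Proof.
move=> mH H2 UU HU isoH i j.
(* [V] exchanges columns [i] and [j] of [U] and fixes the other columns. *)
pose V := U *m tperm_mx i j *m U^t*.
have UU1 : U^t* *m U = 1%:M by exact/mulmx1C/unitarymxP.
have VU : V \is unitarymx.
  apply: mul_unitarymx; last by rewrite trmxC_unitary.
  apply: mul_unitarymx; [exact: UU|apply/unitarymxP].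
  by rewrite tr_tperm_mx map_tperm_mx -perm_mxM perm.tperm2 perm_mx1.
have swap W : column_energy U i (W *m V) = column_energy U j W.
  have WVU : W *m V *m U = xcol i j (W *m U).
    by rewrite xcolE /V !mulmxA -[_ *m U^t* *m U]mulmxA UU1 mulmx1.
  rewrite /column_energy WVU !mxE; congr complex.Re; apply: eq_bigr => l _.
  by rewrite 5!mxE [in RHS]mxE [in RHS]mxE perm.tpermL.
(* The domain is arbitrary because the fact is applied both on [Omega] and on the space of
   matrices. *)
have mphi (d' : measure_display) (T : measurableType d')
    (X : T -> 'M[R[i]]_(m, n)) (l : 'I_n) : mx_measurable X ->
    measurable_fun setT (column_energy U l \o X).
  move=> mX; have [] // : complex_measurable
    (fun w => ((X w *m U)^t* *m (X w *m U)) l l).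
  have mXU : mx_measurable (fun w => X w *m U).
    by apply: mx_measurableM => //; exact: mx_measurable_cst.
  by apply: mx_measurableM => //; exact: mx_measurable_adj.
have mH' := random_matrix_measurable mH.
rewrite !(eigenvalue_column_energy mH H2 UU HU).
have -> : column_energy U j \o H = column_energy U i \o (fun w => H w *m V).
  by apply/funext => w /=; rewrite swap.
congr fine; apply/esym/same_law_expectation; last exact: isoH.
- by apply: mphi; exact: mx_measurable_cylinder_id.
- exact: column_energy_ge0.
- by apply: mphi; apply: mx_measurableM => //; exact: mx_measurable_cst.
- exact: mphi.
Qed.

End sensing_law.

(** * The tangent inequality for the mean squared error *)

Section real_gap.
Variables (R : realType) (n t : nat) (a b : 'rV[R]_n) (k : R).
Variable Y : 'M[R[i]]_(n, t).
Hypotheses (a_gt0 : forall i, 0 < a 0 i) (b_gt0 : forall i, 0 < b 0 i).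
Hypothesis (k_ge0 : 0 <= k).

Let S := regularized_gram (map_mx (real_complex R) a) k%:C Y.

Lemma re_trace_inv_ge0 : 0 <= complex.Re (\tr (invmx S)).
Proof.
have : 0 <= \tr (invmx S).
  by apply: trace_inv_ge0 => [i|]; rewrite ?mxE ?ltcR ?lecR.
by rewrite lecE => /andP[].
Qed.

Lemma re_trace_inv_gap :
  let gap := complex.Re (\tr (invmx S)) - \sum_i (2 / b 0 i -
    (a 0 i + k * complex.Re ((Y *m Y^t*) i i)) / b 0 i ^+ 2) in
  0 <= gap /\ (gap = 0 -> S = real_diag b).
Proof.
have a_gt0' i : 0 < (map_mx (real_complex R) a) 0 i by rewrite mxE ltcR.
have b_gt0' i : 0 < (map_mx (real_complex R) b) 0 i by rewrite mxE ltcR.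
have k_ge0' : 0 <= k%:C by rewrite lecR.
have [] := trace_inv_gap Y a_gt0' k_ge0' b_gt0'; rewrite -/S.
set s := \sum_i _; set s' := \sum_i _.
have -> : s = s'%:C.
  rewrite rmorph_sum; apply: eq_bigr => i _.
  have -> : \sum_j `|Y i j| ^+ 2 = (complex.Re ((Y *m Y^t*) i i))%:C.
    rewrite -mulmx_adj_diag RRe_real// mulmx_adj_diag.
    by apply: sum_real => j _; rewrite realX// normr_real.
  move: (complex.Re _) => z; rewrite !mxE.
  by rewrite rmorphB/= !fmorph_div/= rmorph_nat rmorphD/= rmorphM/= rmorphXn.
(* A nonnegative complex number has zero imaginary part, so the gap vanishes as soon as its real
   part does. *)
case: (\tr _) => x y; rewrite lecE /= subr0.
move=> /andP[/eqP y0 x_ge0] gap0; split=> // xs.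
by apply: gap0; apply/eqP; rewrite eq_complex/= xs subr0 y0 !eqxx.
Qed.

End real_gap.

(** The bound holds channel by channel, by complementary slackness with multiplier
    [kappa / nu ^+ 2]. With [a = 1 / lambda_i]: if [a < nu], then [b = nu], the slopes in [y] cancel
    and equality holds; if [nu <= a], then [b = a], no power is allocated, and [y] has coefficient
    [kappa / nu ^+ 2 - kappa / a ^+ 2 >= 0]. *)
Lemma water_filling_bound (R : realType) (m t : nat) (kappa nu : R)
    (lambda y b : 'rV[R]_m) :
  0 < kappa -> (0 < t)%N -> 0 < nu -> (forall i, 0 < lambda 0 i) ->
  is_water_level t kappa lambda nu -> (forall i, 0 <= y 0 i) ->
  (forall i, b 0 i = (lambda 0 i)^-1 +
     kappa * t%:R * water_power t kappa lambda nu i) ->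
  \sum_i (b 0 i)^-1 + kappa / nu ^+ 2 * (m * t)%:R <=
  \sum_i (2 / b 0 i - ((lambda 0 i)^-1 + kappa * y 0 i) / b 0 i ^+ 2) +
    kappa / nu ^+ 2 * \sum_i y 0 i.
Proof.
move=> kappa_gt0 t_gt0 nu_gt0 lambda_gt0 [_ power_sum] y_ge0 bE.
have t_gt0' : 0 < t%:R :> R by rewrite ltr0n.
rewrite natrM -power_sum mulr_suml !mulr_sumr -!big_split/=.
apply: ler_sum => i _; rewrite bE /water_power; set a := (lambda 0 i)^-1.
have a_gt0 : 0 < a by rewrite invr_gt0.
rewrite mulVKf ?mulf_neq0 ?gt_eqF//.
have yk : 0 <= kappa * y 0 i by rewrite mulr_ge0 ?y_ge0 ?ltW.
have [nua|anu] := leP nu a.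
  rewrite max_r ?subr_le0// !(mulr0, mul0r) !addr0.
  have -> : 2 / a - (a + kappa * y 0 i) / a ^+ 2 =
            a^-1 - kappa * y 0 i / a ^+ 2.
    by field; rewrite gt_eqF.
  rewrite -addrA lerDl addrC subr_ge0 mulrAC.
  rewrite ler_wpM2r// ler_wpM2l ?(ltW kappa_gt0)//.
  by rewrite lef_pV2 ?posrE ?exprn_gt0// lerXn2r ?nnegrE ?(ltW a_gt0) ?(ltW nu_gt0).
rewrite max_l ?subr_ge0 ?(ltW anu)// subrKC.
rewrite le_eqVlt; apply/orP; left; apply/eqP; field.
by rewrite !gt_eqF.
Qed.

(** The excess [f + c q - (e + c s)] is nonnegative pointwise and has expectation at most 0, so it
    vanishes almost surely. *)
Lemma ae_eq_of_expectation_le (R : realType) (d : measure_display)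
    (Omega : measurableType d) (P : probability Omega R)
    (f q : Omega -> R) (c e s : R) :
  measurable_fun setT f -> measurable_fun setT q ->
  (forall w, 0 <= f w) -> (forall w, 0 <= q w) ->
  ('E_P[f] <= e%:E)%E -> ('E_P[q] = s%:E)%E ->
  (forall w, e + c * s <= f w + c * q w) ->
  {ae P, forall w, f w + c * q w = e + c * s}.
Proof.
move=> mf mq f_ge0 q_ge0; rewrite unlock => fe qs fq.
have integ (h : Omega -> R) (z : R) : measurable_fun setT h ->
    (forall w, 0 <= h w) -> (\int[P]_w (h w)%:E <= z%:E)%E ->
    P.-integrable setT (EFin \o h).
  move=> mh h_ge0 hz; apply/integrableP; split; first exact/measurable_EFinP.
  apply: le_lt_trans (ltry z); apply: le_trans hz.
  by under eq_integral do rewrite /= ger0_norm//.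
have f1 := integ f e mf f_ge0 fe.
have q1 : P.-integrable setT (EFin \o q) by apply: (integ q s) => //; rewrite qs.
pose g w := f w + c * q w - (e + c * s).
have mg : measurable_fun setT g.
  apply: measurable_funB; last exact: measurable_cst.
  by apply: measurable_funD => //; apply: measurable_funM.
have cq1 : P.-integrable setT (EFin \o (fun w => c * q w)).
  exact: (integrableZl measurableT c q1).
have g_ge0 w : 0 <= g w by rewrite subr_ge0.
have fcq1 : P.-integrable setT (EFin \o (fun w => f w + c * q w)).
  exact: (integrableD measurableT f1 cq1).
have c1 : P.-integrable setT (EFin \o (fun=> e + c * s)).
  exact: finite_measure_integrable_cst.
have g0 : (\int[P]_w `|(g w)%:E| = 0)%E.
  apply/eqP; rewrite eq_le integral_ge0 ?andbT//.
  under eq_integral do rewrite gee0_abs ?lee_fin//.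
  rewrite (integralB_EFin measurableT fcq1 c1) (integralD_EFin measurableT f1 cq1).
  have := integralZl measurableT q1 c; rewrite /= qs => ->.
  rewrite integral_cst//= probability_setT mule1.
  by rewrite sube_le0 EFinD EFinM leeD.
have mg' : measurable_fun setT (EFin \o g) by exact/measurable_EFinP.
have [/(_ g0) g_ae _] := ae_eq_integral_abs P measurableT mg'.
apply: filterS g_ae => w /(_ I) /= [] /eqP.
by rewrite subr_eq0 => /eqP.
Qed.

(** * Sample covariances in the eigenbasis *)

Section sample_covariance.
Variables (R : realType) (n t : nat).

Lemma invmx_unitary_conj (U A : 'M[R[i]]_n) :
  U \is unitarymx -> A \in unitmx ->
  invmx (U *m A *m U^t*) = U *m invmx A *m U^t*.
Proof.
move=> UU uA; have /unitarymxP UU2 := UU; have UU1 := mulmx1C UU2.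
have E : U *m A *m U^t* *m (U *m invmx A *m U^t*) = 1%:M.
  by rewrite !mulmxA -[_ *m U^t* *m U]mulmxA UU1 mulmx1 mulmxK.
have [u _] := mulmx1_unit E.
by rewrite -[RHS](mulKmx u) E mulmx1.
Qed.

Lemma real_diag_unitV (v : 'rV[R]_n) : (forall i, 0 < v 0 i) ->
  real_diag v \in unitmx /\
  invmx (real_diag v) = real_diag (\row_i (v 0 i)^-1).
Proof.
move=> v_gt0.
have E : real_diag v *m real_diag (\row_i (v 0 i)^-1) = 1%:M.
  rewrite mulmx_diag -diag_const_mx; congr diag_mx.
  by apply/rowP => i; rewrite !mxE -rmorphM mulfV// gt_eqF.
have [u _] := mulmx1_unit E.
by split=> //; rewrite -[RHS](mulKmx u) E mulmx1.
Qed.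

(** The matrix to invert is the conjugate by [U] of a regularized Gram matrix, and the trace ignores
    this conjugation. The factor [t] cancels the normalization of [sample_cov]. *)
Lemma trace_inv_sample_cov (kappa : R) (U : 'M[R[i]]_n) (v : 'rV[R]_n)
    (X : 'M[R[i]]_(n, t)) :
  (0 < t)%N -> 0 <= kappa -> U \is unitarymx -> (forall i, 0 < v 0 i) ->
  \tr (invmx (invmx (U *m real_diag v *m U^t*) +
              (kappa * t%:R)%:C *: sample_cov X)) =
  \tr (invmx (regularized_gram (map_mx (real_complex R) (\row_i (v 0 i)^-1))
                kappa%:C (U^t* *m X))).
Proof.
move=> t_gt0 kappa_ge0 UU v_gt0; have [uv vV] := real_diag_unitV v_gt0.
rewrite (invmx_unitary_conj UU uv) vV.
have /unitarymxP UU2 := UU; have UU1 := mulmx1C UU2.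
set S := regularized_gram _ _ _.
have SU : S \in unitmx.
  by apply: regularized_gram_unit => [i|]; rewrite ?mxE ?ltcR ?lecR ?invr_gt0.
have -> : U *m real_diag (\row_i (v 0 i)^-1) *m U^t* +
    (kappa * t%:R)%:C *: sample_cov X = U *m S *m U^t*.
  rewrite /S /regularized_gram mulmxDr mulmxDl; congr (_ + _).
  rewrite /sample_cov scalerA -scalemxAr -scalemxAl; congr (_ *: _).
    rewrite rmorphM rmorph_nat mulfK// pnatr_eq0 -lt0n//.
  by rewrite adj_mulmx adjK !mulmxA UU2 mul1mx mulmxtVK.
by rewrite (invmx_unitary_conj UU SU) mxtrace_mulC mulmxA UU1 mul1mx.
Qed.

(** Scale the columns of [U] by [sqrt (t p_i)] and pad with zero columns. The padding matrix has
    orthonormal rows because [n <= t]. *)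
Lemma sample_cov_surj (U : 'M[R[i]]_n) (p : 'rV[R]_n) :
  (0 < t)%N -> (n <= t)%N -> U \is unitarymx -> (forall i, 0 <= p 0 i) ->
  exists X : 'M[R[i]]_(n, t), X *m X^t* = t%:R *: (U *m real_diag p *m U^t*).
Proof.
move=> t_gt0 nt UU p_ge0.
pose r : 'rV[R]_n := \row_i Num.sqrt (t%:R * p 0 i).
exists (U *m real_diag r *m pid_mx n).
rewrite !adj_mulmx !mulmxA -[_ *m pid_mx n *m _]mulmxA.
have -> : (pid_mx n : 'M[R[i]]_(n, t)) *m (pid_mx n)^t* = 1%:M.
  rewrite tr_pid_mx map_pid_mx mul_pid_mx minnn.
  by rewrite (minn_idPr nt) pid_mx_1.
rewrite mulmx1 -[U *m _ *m _]mulmxA scalemxAl scalemxAr; congr (_ *m _ *m _).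
rewrite tr_diag_mx map_diag_mx mulmx_diag -linearZ/=; congr diag_mx.
apply/rowP => i; rewrite !mxE.
have -> : Num.conj (Num.sqrt (t%:R * p 0 i))%:C = (Num.sqrt (t%:R * p 0 i))%:C.
  by apply/conj_Creal/complex_realP; eexists.
by rewrite -rmorphM -expr2 sqr_sqrtr ?mulr_ge0// rmorphM rmorph_nat.
Qed.

End sample_covariance.

(** * Pointwise optimality of the water-filling covariance *)

Section deterministic_input.
Variables (R : realType) (M T : nat) (kappa nu : R) (lambda : 'rV[R]_M).
Variable Us : 'M[R[i]]_M.
Hypotheses (T_gt0 : (0 < T)%N) (kappa_gt0 : 0 < kappa).
Hypotheses (lambda_gt0 : forall i, 0 < lambda 0 i) (Us_unitary : Us \is unitarymx).
Hypotheses (nu_gt0 : 0 < nu) (nu_level : is_water_level T kappa lambda nu).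

Let Rs := Us *m real_diag lambda *m Us^t*.
Let a : 'rV[R]_M := \row_i (lambda 0 i)^-1.
Let S (X : 'M[R[i]]_(M, T)) :=
  regularized_gram (map_mx (real_complex R) a) kappa%:C (Us^t* *m X).

Definition optimal_powers : 'rV[R]_M :=
  \row_i water_power T kappa lambda nu i.

(** These entries equal [max (nu, 1 / lambda_i)], the point at which the tangent is taken. *)
Definition optimal_precisions : 'rV[R]_M :=
  \row_i ((lambda 0 i)^-1 + kappa * T%:R * water_power T kappa lambda nu i).

Definition mmse (X : 'M[R[i]]_(M, T)) : R := complex.Re
  (\tr (invmx (invmx Rs + (kappa * T%:R)%:C *: sample_cov X))).

Definition input_energy (X : 'M[R[i]]_(M, T)) : R :=
  complex.Re (\tr (X *m X^t*)).

Definition min_mmse : R := \sum_i (optimal_precisions 0 i)^-1.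

Local Notation p := optimal_powers.
Local Notation b := optimal_precisions.

Let kT_gt0 : 0 < kappa * T%:R. Proof. by rewrite mulr_gt0 ?ltr0n. Qed.

Let a_gt0 i : 0 < a 0 i. Proof. by rewrite mxE invr_gt0. Qed.

Let UU2 : Us *m Us^t* = 1%:M. Proof. exact/unitarymxP. Qed.

Let UU1 : Us^t* *m Us = 1%:M. Proof. exact: mulmx1C. Qed.

Lemma optimal_powers_ge0 i : 0 <= p 0 i.
Proof. by rewrite mxE water_power_ge0. Qed.

Lemma optimal_precisions_gt0 i : 0 < b 0 i.
Proof.
by rewrite mxE ltr_pwDl ?invr_gt0// mulr_ge0 ?(ltW kT_gt0)// water_power_ge0.
Qed.

Lemma mmseE X : mmse X = complex.Re (\tr (invmx (S X))).
Proof.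
exact: (congr1 (@complex.Re R) (trace_inv_sample_cov X T_gt0 (ltW kappa_gt0)
  Us_unitary lambda_gt0)).
Qed.

Lemma mmse_ge0 X : 0 <= mmse X.
Proof. by rewrite mmseE re_trace_inv_ge0// ltW. Qed.

(** This translates the equality case of the tangent inequality into a condition on the input: [b]
    is [a + kappa T p], so [a] and [kappa] cancel and only the rotation by [Us] remains. *)
Lemma optimal_gramP X : S X = real_diag b <->
  X *m X^t* = T%:R *: (Us *m real_diag p *m Us^t*).
Proof.
have -> : real_diag b = diag_mx (map_mx (real_complex R) a) +
    kappa%:C *: (T%:R *: real_diag p).
  have bE : map_mx (real_complex R) b = map_mx (real_complex R) a +
      kappa%:C *: (T%:R *: map_mx (real_complex R) p).
    by apply/rowP => i; rewrite !mxE rmorphD/= !rmorphM/= rmorph_nat !mulrA.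
  by rewrite /real_diag bE linearD/= !linearZ/= !scalerA [kappa%:C * _]mulrC.
rewrite /S /regularized_gram adj_mulmx adjK mulmxA -[Us^t* *m X *m _]mulmxA.
have kappa_neq0 : kappa%:C != 0 by rewrite eq_complex/= gt_eqF.
split=> [/addrI/(scalerI kappa_neq0) XX|->].
  rewrite scalemxAl scalemxAr -XX !mulmxA UU2 mul1mx.
  by rewrite -[_ *m Us *m Us^t*]mulmxA UU2 mulmx1.
rewrite -scalemxAr -scalemxAl !mulmxA UU1 mul1mx -[_ *m _ *m Us]mulmxA UU1.
by rewrite mulmx1.
Qed.

Lemma Re_sum (I : finType) (F : I -> R[i]) :
  complex.Re (\sum_i F i) = \sum_i complex.Re (F i).
Proof. by apply: (big_morph (@complex.Re R)) => // x z; exact: ReD. Qed.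

Lemma input_energy_ge0 X : 0 <= input_energy X.
Proof.
by have := mxtrace_mulmx_adj_ge0 X; rewrite lecE => /andP[].
Qed.

Lemma optimal_input_value X :
  X *m X^t* = T%:R *: (Us *m real_diag p *m Us^t*) ->
  mmse X = min_mmse /\ input_energy X = (M * T)%:R.
Proof.
move=> Xopt; split.
  rewrite mmseE ((optimal_gramP X).2 Xopt).
  rewrite (real_diag_unitV optimal_precisions_gt0).2 mxtrace_diag Re_sum.
  by apply: eq_bigr => i _; rewrite !mxE.
rewrite /input_energy Xopt mxtraceZ mxtrace_mulC mulmxA UU1 mul1mx mxtrace_diag.
under eq_bigr do rewrite !mxE.
rewrite -rmorph_sum/= -[T%:R](rmorph_nat (real_complex R)) -rmorphM/=.
by have [_ ->] := nu_level; rewrite natrM mulrC.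
Qed.

(** The tangent inequality at [b] is chained with the water-filling bound. Equality overall leaves
    no room in the first inequality, whose equality case fixes [X X^*]. *)
Lemma mmse_bound X :
  let c := kappa / nu ^+ 2 in
  min_mmse + c * (M * T)%:R <= mmse X + c * input_energy X /\
  (mmse X + c * input_energy X = min_mmse + c * (M * T)%:R ->
   X *m X^t* = T%:R *: (Us *m real_diag p *m Us^t*)).
Proof.
move=> c; set Y := Us^t* *m X.
pose y := \row_(i < M) complex.Re ((Y *m Y^t*) i i).
have y_ge0 i : 0 <= y 0 i.
  rewrite mxE; suff : 0 <= (Y *m Y^t*) i i by rewrite lecE => /andP[].
  by rewrite mulmx_adj_diag; apply: sumr_ge0 => k _; rewrite exprn_ge0.
have y_sum : \sum_i y 0 i = input_energy X.
  rewrite /input_energy -[X in X *m _]mul1mx -UU2 -!mulmxA mxtrace_mulC.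
  rewrite -mulmxA -{2}[Us]adjK -mulmxA -adj_mulmx -/Y mulmxA /mxtrace Re_sum.
  by apply: eq_bigr => i _; rewrite mxE.
have [] := re_trace_inv_gap Y a_gt0 optimal_precisions_gt0 (ltW kappa_gt0).
rewrite -mmseE subr_ge0 => gap_ge0 gap_eq0.
have := @water_filling_bound _ _ _ _ _ _ y b kappa_gt0 T_gt0 nu_gt0 lambda_gt0
  nu_level y_ge0.
rewrite y_sum -/c -/min_mmse => /(_ (fun i => mxE _ _ _ _)) bound.
have sumE : \sum_i (2 / b 0 i - ((lambda 0 i)^-1 + kappa * y 0 i) / b 0 i ^+ 2) =
    \sum_i (2 / b 0 i - (a 0 i + kappa * complex.Re ((Y *m Y^t*) i i)) / b 0 i ^+ 2).
  by apply: eq_bigr => i _; rewrite [a 0 i]mxE [y 0 i]mxE.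
rewrite sumE in bound; split; first by apply: le_trans bound _; rewrite lerD2r.
move=> eq_bound; apply/optimal_gramP/gap_eq0/eqP; rewrite eq_le subr_ge0 gap_ge0.
by rewrite andbT subr_le0 -(lerD2r (c * input_energy X)) eq_bound.
Qed.

End deterministic_input.

Theorem proposition1 (R : realType) (d : measure_display)
    (Omega : measurableType d) (P : probability Omega R)
    (M T Ns : nat) (M_gt0 : (0 < M)%N) (T_gt0 : (0 < T)%N)
    (Ns_gt0 : (0 < Ns)%N) (leMT : (M <= T)%N)
    (sigma2 : R) (sigma2_gt0 : 0 < sigma2)
    (kappa : R) (kappaE : kappa = 1 / (sigma2 * Ns%:R))
    (Hs : Omega -> 'M[R[i]]_(Ns, M)) (Hs_random : random_matrix Hs)
    (Hs_moments : finite_second_moments P Hs)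
    (Rs : 'M[R[i]]_M)
    (RsE : Rs = mx_expectation P (fun w => (Hs w)^t* *m Hs w))
    (Rs_unit : Rs \in unitmx)
    (Us : 'M[R[i]]_M) (Us_unitary : Us \is unitarymx)
    (lambda : 'rV[R]_M)
    (Rs_eigen : Rs = Us *m real_diag lambda *m Us^t*)
    (Xstar : Omega -> 'M[R[i]]_(M, T))
    (Xstar_min : minimizes_EMMSE P Rs kappa Xstar) :
  exists RXstar : 'M[R[i]]_M,
    {ae P, forall w, sample_cov (Xstar w) = RXstar} /\
    exists dstar : 'rV[R]_M,
      [/\ forall i, 0 <= dstar 0 i,
          RXstar = Us *m (real_diag dstar *m real_diag dstar) *m Us^t*,
          exists nu : R,
            unique (is_water_level T kappa lambda) nu /\
            forall i, dstar 0 i ^+ 2 = water_power T kappa lambda nu i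
        & isotropic P Hs -> is_scalar_mx Rs /\ forall i, dstar 0 i = 1].
Proof.
have kappa_gt0 : 0 < kappa by rewrite kappaE div1r invr_gt0 mulr_gt0 ?ltr0n.
have kT_gt0 : 0 < kappa * T%:R by rewrite mulr_gt0 ?ltr0n.
have HU : mx_expectation P (fun w => (Hs w)^t* *m Hs w) =
  Us *m real_diag lambda *m Us^t* by rewrite -RsE.
(* Eigenvalues are nonnegative as mean energies, and nonzero because [Rs] is invertible. *)
have lambda_gt0 : forall i, 0 < lambda 0 i.
  move=> i; rewrite lt0r; apply/andP; split.
    move: Rs_unit; rewrite Rs_eigen !unitmx_mul => /andP[/andP[_ +] _].
    rewrite unitmxE unitfE det_diag => /prodf_neq0/(_ i isT).
    by rewrite mxE; apply: contraNN => /eqP ->.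
  rewrite (eigenvalue_column_energy Hs_random Hs_moments Us_unitary HU).
  by apply/fine_ge0/expectation_ge0 => w; exact: column_energy_ge0.
have [nu [nu_level nu_gt0]] := water_level_unique_exists M_gt0 kT_gt0 lambda_gt0.
pose p := optimal_powers T kappa nu lambda.
have p_ge0 i : 0 <= p 0 i by exact: optimal_powers_ge0.
have [[Xstar_random Xstar_energy] Xstar_opt] := Xstar_min.
have optimal_ae : {ae P, forall w,
    Xstar w *m (Xstar w)^t* = T%:R *: (Us *m real_diag p *m Us^t*)}.
  have [Xopt Xopt_cov] := sample_cov_surj T_gt0 leMT Us_unitary p_ge0.
  have [mmse_opt energy_opt] := optimal_input_value T_gt0 kappa_gt0 lambda_gt0
    Us_unitary nu_level.1 Xopt_cov.
  have feasible_opt : feasible P (fun=> Xopt).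
    split; first exact: random_matrix_cst.
    by rewrite expectation_cst -/(input_energy Xopt) energy_opt.
  have mX := random_matrix_measurable Xstar_random.
  have bound w := mmse_bound T_gt0 kappa_gt0 lambda_gt0 Us_unitary nu_gt0
    nu_level.1 (Xstar w).
  suff ae_eq : {ae P, forall w,
      mmse kappa lambda Us (Xstar w) +
      kappa / nu ^+ 2 * input_energy (Xstar w) =
      min_mmse T kappa nu lambda + kappa / nu ^+ 2 * (M * T)%:R}.
    by apply: filterS ae_eq => w; exact: (bound w).2.
  apply: ae_eq_of_expectation_le => [||w|w|||w]; last first.
  - exact: (bound w).1.
  - exact: Xstar_energy.
  (* Minimality is tested against the constant input [Xopt], whose expected error is [min_mmse]. *)
  - rewrite -mmse_opt -(expectation_cst P) /mmse -Rs_eigen.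
    exact: (Xstar_opt _ feasible_opt).
  - exact: input_energy_ge0.
  - exact: mmse_ge0.
  - have [] // : complex_measurable (fun w => \tr (Xstar w *m (Xstar w)^t*)).
    apply/complex_measurable_tr/mx_measurableM => //.
    exact: mx_measurable_adj.
  (* The regularized Gram form is invertible at every [w], as measurability of the matrix inverse
     demands. *)
  - pose Y w := regularized_gram
      (map_mx (real_complex R) (\row_i (lambda 0 i)^-1)) kappa%:C
      (Us^t* *m Xstar w).
    rewrite (_ : (fun w => _) = (fun w => complex.Re (\tr (invmx (Y w)))));
      last by apply/funext => w; exact: mmseE.
    have [] // : complex_measurable (fun w => \tr (invmx (Y w))).
    apply/complex_measurable_tr/mx_measurable_inv => [w|].
      apply: regularized_gram_unit; last by rewrite lecR ltW.
      by move=> i; rewrite !mxE ltcR invr_gt0.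
    have mUX : mx_measurable (fun w => Us^t* *m Xstar w).
      by apply: mx_measurableM => //; exact: mx_measurable_cst.
    apply: mx_measurableD; first exact: mx_measurable_cst.
    apply: mx_measurableZ; apply: mx_measurableM => //.
    exact: mx_measurable_adj.
exists (Us *m real_diag p *m Us^t*); split.
  apply: filterS optimal_ae => w XX.
  by rewrite /sample_cov XX scalerA mulVf ?scale1r// pnatr_eq0 -lt0n.
exists (\row_i Num.sqrt (p 0 i)); split.
- by move=> i; rewrite mxE sqrtr_ge0.
- congr (_ *m _ *m _); rewrite mulmx_diag; congr diag_mx.
  by apply/rowP => i; rewrite [LHS]mxE 3![in RHS]mxE -rmorphM -expr2 sqr_sqrtr.
- by exists nu; split=> // i; rewrite mxE sqr_sqrtr// mxE.
move=> /(isotropic_eigenvalues Hs_random Hs_moments Us_unitary HU) lambdaC.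
pose i0 := Ordinal M_gt0; split.
  have -> : Rs = ((lambda 0 i0)%:C)%:M; last exact: scalar_mx_is_scalar.
  have -> : Rs = Us *m ((lambda 0 i0)%:C)%:M *m Us^t*.
    rewrite Rs_eigen -diag_const_mx; congr (_ *m diag_mx _ *m _).
    by apply/rowP => i; rewrite !mxE (lambdaC i i0).
  by rewrite scalar_mxC -mulmxA (unitarymxP _) ?mulmx1.
move=> i; rewrite mxE.
(* Equal eigenvalues receive equal powers, and [M] equal powers with sum [M] are all 1. *)
have p_const j : water_power T kappa lambda nu j = p 0 i.
  by rewrite mxE /water_power (lambdaC j i).
suff -> : p 0 i = 1 by rewrite sqrtr1.
have [_] := nu_level.1.
under eq_bigr => j _ do rewrite p_const.
have M_neq0 : M%:R != 0 :> R by rewrite pnatr_eq0 -lt0n.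
by rewrite sumr_const card_ord -[RHS]mulr1 -[LHS]mulr_natl => /(mulfI M_neq0).
Qed.
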